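(* The operation $\oplus_f$ (fiber convolution) defines an abelian monoid structure on the set of Probability Vector Fields on $\mathcal{P}(\mathbb{R}^n)$.
   Context: $T\mathbb{R}^n=\mathbb{R}^n\times\mathbb{R}^n$ with points $(x,v)$, $\pi_1(x,v)=x$; $\mathcal{P}(X)$ is the set of Borel probability measures on $X$. A Probability Vector Field (PVF) is a map $V:\mathcal{P}(\mathbb{R}^n)\to\mathcal{P}(T\mathbb{R}^n)$ with $\pi_1\#V[\mu]=\mu$ for every $\mu$. The measure $\mu\otimes\nu_x$ is defined by $\int\phi\,d(\mu\otimes\nu_x)=\int\int\phi(x,v)\,d\nu_x(v)\,d\mu(x)$. Fiber convolution: for $\mu_b\otimes\mu_x,\ \mu_b\otimes\nu_x\in\mathcal{P}(T\mathbb{R}^n)$ with the same base marginal $\mu_b$ and Borel $B\subset T\mathbb{R}^n$, $$(\mu_b\otimes\mu_x)\ast_f(\mu_b\otimes\nu_x)(B)=\int_{\mathbb{R}^n}\Big(\int_{(\mathbb{R}^n)^2}\chi_B(x,v+w)\,d\mu_x(v)\,d\nu_x(w)\Big)d\mu_b(x).$$ For PVFs $V_1,V_2$, write the disintegration $V_i[\mu]=\mu\otimes\nu^i_x[\mu]$ with respect to the base (unique up to $\mu$-null sets) and set $(V_1\oplus_f V_2)[\mu]=(\mu\otimes\nu^1_x[\mu])\ast_f(\mu\otimes\nu^2_x[\mu])$. *)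

(* Defs.v *)
From HB Require Import structures.
From mathcomp Require Import all_boot all_order all_algebra.
From mathcomp Require Import all_classical all_reals all_analysis.
From mathcomp Require Import measurable_realfun.
Import Order.TTheory GRing.Theory Num.Theory.
Import numFieldNormedType.Exports.
Set Implicit Arguments.
Unset Strict Implicit.
Unset Printing Implicit Defensive.
Local Open Scope classical_set_scope.
Local Open Scope ring_scope.
Local Open Scope ereal_scope.

Definition Rn (R : realType) (n : nat) := g_sigma_algebraType (@open 'rV[R]_n).

HB.instance Definition _ (R : realType) (n : nat) := Measurable.on (Rn R n).

(* Product sigma-algebra; it is the Borel sigma-algebra of the product
   topology, see [measurable_TRnE]. *)
Notation TRn R n := (Rn R n * Rn R n)%type.

Lemma measurable_TRnE (R : realType) (n : nat) :
  (measurable : set (set (TRn R n))) = <<s @open ('rV[R]_n * 'rV[R]_n)%type >>.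
Proof.
rewrite eqEsubset; split.
  apply: smallest_sub; first exact: smallest_sigma_algebra.
  have preim (f : 'rV[R]_n * 'rV[R]_n -> 'rV[R]_n) : continuous f ->
      preimage_set_system setT f (measurable : set (set (Rn R n))) `<=`
      <<s @open ('rV[R]_n * 'rV[R]_n)%type >>.
    move=> /continuousP cf.
    have mf : @measurable_fun _ _ (g_sigma_algebraType
        (@open ('rV[R]_n * 'rV[R]_n)%type)) (Rn R n) setT f.
      apply: measurability; first reflexivity.
      move=> _ [A oA <-].
      by rewrite setTI; apply: sub_sigma_algebra; exact: cf.
    by move=> _ [A mA <-]; exact: mf.
  rewrite subUset; split; apply: preim => x; [exact: cvg_fst|exact: cvg_snd].
apply: smallest_sub; first exact: sigma_algebra_measurable.
move=> U oU.
pose q (p : 'rV[rat]_n) : 'rV[R]_n := map_mx ratr p.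
pose box (i : 'rV[rat]_n * 'rV[rat]_n * nat) : set (TRn R n) :=
  ball (q i.1.1) i.2.+1%:R^-1 `*` ball (q i.1.2) i.2.+1%:R^-1.
pose F i : set (TRn R n) := if `[< box i `<=` U >] then box i else set0.
suff -> : U = \bigcup_i F i.
  apply: countable_bigcupT_measurable; first exact: countableP.
  move=> i; rewrite /F; case: ifPn => // _.
  by apply: measurableX; apply: sub_sigma_algebra; exact: ball_open.
rewrite eqEsubset; split => [[x y] Uxy|z [i _]]; last first.
  by rewrite /F; case: ifPn => // /asboolP; exact.
have [e /= e0 eU] : nbhs_ball (x, y) U by apply/nbhs_ballP; exact: open_nbhs_nbhs.
have [k ke] : exists k : nat, (k.+1%:R^-1 < e / 2 :> R)%R.
  have e20 : (0 < e / 2)%R by rewrite divr_gt0.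
  have [k _ kP] := near_infty_natSinv_lt (PosNum e20).
  by exists k; exact: kP k (leqnn k).
have k0 : (0 < k.+1%:R^-1 :> R)%R by rewrite invr_gt0.
have approx (v : 'rV[R]_n) : exists p, ball (q p) k.+1%:R^-1 v.
  have /choice[p pP] : forall j, exists r : rat, (`|v ord0 j - ratr r| < k.+1%:R^-1)%R.
    move=> j; have /rat_in_itvoo[r] : (v ord0 j - k.+1%:R^-1 < v ord0 j + k.+1%:R^-1)%R.
      by rewrite ltrD2l gtrN.
    by rewrite in_itv/= => rj; exists r; rewrite ltr_distlC.
  exists (\row_j p j); split => // i j.
  by rewrite !mxE -ball_normE /= distrC ord1.
have [[p xp] [p' yp]] := (approx x, approx y).
exists (p, p', k) => //; rewrite /F ifT; first by split.
have half (a b c : 'rV[R]_n) : ball a k.+1%:R^-1 b -> ball a k.+1%:R^-1 c ->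
    ball b e c.
  move=> ab ac; rewrite [e]splitr; apply: (@ball_triangle _ _ a).
    exact/ball_sym/(le_ball (ltW ke)).
  exact: (le_ball (ltW ke)).
by apply/asboolP => -[x' y'] [/= x'p y'p]; apply: eU; split; [exact: half xp x'p|exact: half yp y'p].
Qed.

Lemma eq_probability d (T : measurableType d) (R : realType)
    (P Q : probability T R) : P = Q :> (set T -> \bar R) -> P = Q.
Proof.
case: P Q => [P cP] [Q cQ] /= PQ.
case: _ / PQ cQ => cQ; congr Probability.Pack.
case: cP cQ => [[p0 p1] [p2] [p3] [p4] [p5] [p6] [p7]].
case=> [[q0 q1] [q2] [q3] [q4] [q5] [q6] [q7]].
by rewrite (Prop_irrelevance q0 p0) (Prop_irrelevance q1 p1)
  (Prop_irrelevance q2 p2) (Prop_irrelevance q3 p3) (Prop_irrelevance q4 p4)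
  (Prop_irrelevance q5 p5) (Prop_irrelevance q6 p6) (Prop_irrelevance q7 p7).
Qed.

(* A measure of the library is a function on all subsets of T, arbitrary on the
   non-measurable ones. Fixing the value 0 there makes Leibniz equality coincide
   with equality of measures [borel_prob_eq]; nothing is lost
   [borel_prob_unique]. *)
Record borel_prob d (T : measurableType d) (R : realType) := BorelProb {
  borel_prob_val :> probability T R;
  borel_prob_out : forall A, ~ measurable A -> borel_prob_val A = 0 }.

Lemma borel_prob_eq d (T : measurableType d) (R : realType)
    (P Q : borel_prob T R) :
  (forall A, measurable A -> P A = Q A) -> P = Q.
Proof.
move=> PQ.
have : borel_prob_val P = borel_prob_val Q.
  apply/eq_probability/funext => A.
  have [mA|nmA] := pselect (measurable A); first exact: PQ.
  by rewrite !borel_prob_out.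
case: P Q {PQ} => [P P0] [Q Q0] /= PQ.
by case: _ / PQ Q0 => Q0; congr BorelProb; exact: Prop_irrelevance.
Qed.

Section normalized.
Context d (T : measurableType d) (R : realType) (P : probability T R).

Definition cut_measure (A : set T) : \bar R :=
  if `[< measurable A >] then P A else 0.

Let cut_measureE A : measurable A -> cut_measure A = P A.
Proof. by move=> mA; rewrite /cut_measure asboolT. Qed.

Let cut_measure0 : cut_measure set0 = 0.
Proof. by rewrite cut_measureE// measure0. Qed.

Let cut_measure_ge0 A : 0 <= cut_measure A.
Proof. by rewrite /cut_measure; case: ifP. Qed.

Let cut_measure_sigma_additive : semi_sigma_additive cut_measure.
Proof.
move=> F mF tF mUF; rewrite cut_measureE//.
under eq_fun do under eq_bigr do rewrite cut_measureE//.
exact: measure_semi_sigma_additive.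
Qed.

HB.instance Definition _ := isMeasure.Build _ _ _ cut_measure
  cut_measure0 cut_measure_ge0 cut_measure_sigma_additive.

Let cut_measureT : cut_measure setT = 1.
Proof. by rewrite cut_measureE// probability_setT. Qed.

HB.instance Definition _ :=
  Measure_isProbability.Build _ _ _ cut_measure cut_measureT.

Lemma borel_prob_unique :
  exists! Q : borel_prob T R, forall A, measurable A -> Q A = P A.
Proof.
have out A : ~ measurable A -> cut_measure A = 0.
  by move=> nmA; rewrite /cut_measure asboolF.
exists (@BorelProb _ _ _ cut_measure out); split; first exact: cut_measureE.
move=> Q QP; apply: borel_prob_eq => A mA.
by rewrite QP//; exact: cut_measureE.
Qed.

End normalized.

Record prob_vector_field (R : realType) (n : nat) := Pvf {
  pvf_fun :> borel_prob (Rn R n) R -> borel_prob (TRn R n) R;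
  pvf_base : forall mu (A : set (Rn R n)), measurable A ->
    pushforward (pvf_fun mu) fst A = mu A }.

HB.instance Definition _ (R : realType) (n : nat) := gen_eqMixin (prob_vector_field R n).
HB.instance Definition _ (R : realType) (n : nat) := gen_choiceMixin (prob_vector_field R n).

(* P is the measure $\mu\otimes\nu_x$ *)
Definition disintegration (R : realType) (n : nat) (mu : probability (Rn R n) R)
    (nu : R.-pker (Rn R n) ~> (Rn R n)) (P : probability (TRn R n) R) : Prop :=
  forall phi : TRn R n -> \bar R,
    measurable_fun [set: TRn R n] phi -> (forall z, 0 <= phi z) ->
    \int[P]_z phi z = \int[mu]_x \int[nu x]_v phi (x, v).

(* $((\mu\otimes\nu^1_x) \ast_f (\mu\otimes\nu^2_x))(B)$ *)
Definition fiber_conv (R : realType) (n : nat) (mu : probability (Rn R n) R)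
    (nu1 nu2 : R.-pker (Rn R n) ~> (Rn R n)) (B : set (TRn R n)) : \bar R :=
  \int[mu]_x \int[nu1 x \x nu2 x]_p
    (\1_B (x, (p.1 : 'rV[R]_n) + (p.2 : 'rV[R]_n))%R)%:E.

Definition is_fiber_sum (R : realType) (n : nat) (V1 V2 W : prob_vector_field R n) :
    Prop :=
  forall (mu : borel_prob (Rn R n) R) (nu1 nu2 : R.-pker (Rn R n) ~> (Rn R n)),
    disintegration mu nu1 (V1 mu) -> disintegration mu nu2 (V2 mu) ->
    forall B, measurable B -> W mu B = fiber_conv mu nu1 nu2 B.

(* [xget] picks the W with [is_fiber_sum V1 V2 W]; its default V1 is returned
   only if no such W existed. *)
Definition fiber_sum (R : realType) (n : nat) (V1 V2 : prob_vector_field R n) :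
    prob_vector_field R n :=
  xget V1 [set W | is_fiber_sum V1 V2 W].

(* Main.v *)
(* The quantile transform yields disintegrations. If P on X * \bar R has
   marginal mu, let F_q be the density with respect to mu of
   A |-> P (A `*` [-oo, q[), for q in a countable dense set, and
   G (x, t) = inf {q | t < F_q x}; then P is the law of (x, G (x, t)) for x ~ mu
   and t uniform on [0, 1], because both measures agree on the sets
   A `*` [-oo, r[. Measures on X * R^n reduce to this case since R^n is a
   measurable retract of R: a vector v is coded by the point of the Cantor set
   whose ternary digits are the truth values of v_j < q.

   Given kernels nu1, nu2 disintegrating V1 mu, V2 mu, the fiber convolution is
   the iterated integral against mu, nu1 x and nu2 x of \1_B (x, v + w). As an
   integral over V1 mu of a function depending on nu2 it does not depend on the
   choice of nu1 and, by Tonelli, symmetrically for nu2. The monoid laws are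
   those of addition on R^n. *)
Require Import Defs.
From HB Require Import structures.
From mathcomp Require Import all_boot all_order all_algebra.
From mathcomp Require Import all_classical all_reals all_analysis.
From mathcomp Require Import measurable_realfun giry lra.
Import Order.TTheory GRing.Theory Num.Theory.
Import numFieldNormedType.Exports.
Set Implicit Arguments.
Unset Strict Implicit.
Unset Printing Implicit Defensive.
Local Open Scope classical_set_scope.
Local Open Scope ring_scope.
Local Open Scope ereal_scope.

(** * Uniform law, almost-everywhere comparison and densities of slices *)

Lemma uniform_prob01_lt (R : realType) (h : R) : (0 <= h <= 1)%R ->
  uniform_prob (@ltr01 R) [set t | (t < h)%R] = h%:E.
Proof.
move=> /andP[h0 h1]; rewrite /uniform_prob integral_uniform_pdf.
have -> : [set t | (t < h)%R] `&` `[0%R, 1%R] = `[0%R, h[%classic.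
  apply/seteqP; split => t /=; rewrite !in_itv/=.
    by move=> [-> /andP[-> _]].
  by move=> /andP[-> th]; rewrite th (ltW (lt_le_trans th h1)).
rewrite (eq_integral (cst 1)); last first.
  move=> t; rewrite inE/= in_itv/= => /andP[t0 th].
  by rewrite /uniform_pdf t0 (ltW (lt_le_trans th h1))/= subr0 invr1.
rewrite integral_cst// mul1e /= lebesgue_measure_itv/= lte_fin.
by case: ltgtP h0 => // [_ _|<-//]; rewrite sube0.
Qed.

(** On the set where g < f, monotonicity gives the reverse inequality of integrals. So f and g have
    equal integrals over all its measurable subsets and agree almost everywhere on it, which leaves
    it null. *)
Lemma le_integral_ae_le d (X : measurableType d) (R : realType)
    (mu : {measure set X -> \bar R}) (f g : X -> \bar R) :
  mu.-integrable setT f -> mu.-integrable setT g ->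
  (forall A, measurable A -> \int[mu]_(x in A) f x <= \int[mu]_(x in A) g x) ->
  {ae mu, forall x, f x <= g x}.
Proof.
move=> fi gi fg.
have mf := measurable_int _ fi; have mg := measurable_int _ gi.
pose N := [set x | g x < f x].
have mN : measurable N by rewrite -[N]setTI; exact: measurable_lte.
have : ae_eq mu N f g.
  apply: integral_ae_eq => //.
  - exact: integrableS fi.
  - exact: measurable_funTS.
  - move=> E EN mE; apply/eqP; rewrite eq_le fg//=; apply: le_integral => //.
    + exact: integrableS gi.
    + exact: integrableS fi.
    + by move=> x; rewrite inE => /EN /ltW.
apply: filterS => x /= fgN; rewrite leNgt; apply/negP => gf.
by have := gf; rewrite (fgN gf) ltxx.
Qed.

Lemma dense_seq (R : realType) :
  exists q : R^nat, forall a b, (a < b)%R -> exists k, (a < q k < b)%R.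
Proof.
exists (fun k => ratr (odflt 0%R (unpickle k))) => a b /rat_in_itvoo[r].
by rewrite in_itv/= => rab; exists (pickle r); rewrite pickleK.
Qed.

Section slice.
Context d d' (X : measurableType d) (Y : measurableType d') (R : realType).
Variables (P : probability (X * Y)%type R) (B : set Y) (mB : measurable B).

Definition slice (A : set X) : \bar R := P (A `*` B).

Let slice0 : slice set0 = 0.
Proof. by rewrite /slice set0X measure0. Qed.

Let slice_ge0 A : 0 <= slice A.
Proof. exact: measure_ge0. Qed.

Let slice_sigma_additive : semi_sigma_additive slice.
Proof.
move=> F mF tF mUF; rewrite /slice setX_bigcupl.
apply: measure_semi_sigma_additive.
- by move=> i; exact: measurableX.
- move/trivIsetP : tF => tF; apply/trivIsetP => i j _ _ ij.
  by rewrite -setXI tF// set0X.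
- by apply: bigcup_measurable => i _; exact: measurableX.
Qed.

HB.instance Definition _ := isMeasure.Build _ _ _ slice
  slice0 slice_ge0 slice_sigma_additive.

Let slice_fin : fin_num_fun slice.
Proof. by move=> A mA; apply: fin_num_measure; exact: measurableX. Qed.

HB.instance Definition _ := Measure_isFinite.Build _ _ _ slice slice_fin.

(** Since [A * B] lies in [A * Y], a set null for the marginal is null for [slice], and
    Radon-Nikodym applies. *)
Lemma exists_density (mu : probability X R) :
  (forall A, measurable A -> P (A `*` [set: Y]) = mu A) ->
  exists F : X -> \bar R, [/\ forall x, 0 <= F x, mu.-integrable setT F &
    forall A, measurable A -> P (A `*` B) = \int[mu]_(x in A) F x].
Proof.
move=> Pmu.
have [F [F0 _ Fi FE]] : exists F : X -> \bar R, [/\ forall x, 0 <= F x,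
    forall x, F x \is a fin_num, mu.-integrable setT F &
    forall A, measurable A -> slice A = \int[mu]_(x in A) F x].
  apply: radon_nikodym_sigma_finite; apply/null_content_dominatesP => A mA muA.
  have PA : P (A `*` [set: Y]) = 0 by rewrite Pmu.
  apply/eqP; rewrite -measure_le0 -PA.
  by apply: le_measure; rewrite ?inE//;
    [exact: measurableX|exact: measurableX|move=> ? []].
by exists F; split.
Qed.

End slice.

(** * Generalized inverses and the quantile transform *)

Section level_inf.
Context d (T : measurableType d) (R : realType).
Variables (q : R^nat) (A : (set T)^nat).

(** Serves twice: as the quantile function, where [A k] is the region below a distribution function
    at level [q k], and as the decoder of a real number from the truth values of its comparisons
    with the [q k]. *)
Definition level_inf (x : T) : \bar R :=
  ereal_inf [set (q k)%:E | k in [set k | A k x]].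

Lemma level_inf_lt x r :
  level_inf x < r%:E <-> exists2 k, (q k < r)%R & A k x.
Proof.
split=> [/ereal_inf_lt[_ [k /= Akx <-]]|[k qr Akx]].
  by rewrite lte_fin => qr; exists k.
apply: (@le_lt_trans _ _ (q k)%:E); last by rewrite lte_fin.
by apply: ereal_inf_lbound; exists k.
Qed.

Hypothesis mA : forall k, measurable (A k).

Lemma measurable_level_inf_lt r : measurable [set x | level_inf x < r%:E].
Proof.
rewrite (_ : [set x | _] = \bigcup_(k in [set k | (q k < r)%R]) A k).
  exact: bigcup_measurable.
apply/seteqP; split => x /=; first by move/level_inf_lt => [k qr Akx]; exists k.
by case=> k qr Akx; apply/level_inf_lt; exists k.
Qed.

Lemma measurable_level_inf : measurable_fun setT level_inf.
Proof.
apply: (measurability _ (ErealGenInftyO.measurableE R)) => _ [_ [r ->] <-].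
by rewrite setTI preimage_itvNyo; exact: measurable_level_inf_lt.
Qed.

End level_inf.

Lemma exists_image d d' (T : measurableType d) (T' : measurableType d')
    (R : realType) (P : probability T R) (f : T -> T') :
  measurable_fun setT f ->
  exists Q : probability T' R, forall A, Q A = P (f @^-1` A).
Proof. by move=> mf; exists (distribution P (mfun_Sub (mem_set mf))). Qed.

(** The products of a measurable set with an open lower ray or with the whole line are stable under
    intersection and generate the product sigma-algebra, so they determine a finite measure. *)
Lemma eq_measure_prod_ereal d (X : measurableType d) (R : realType)
    (m1 m2 : {measure set (X * \bar R)%type -> \bar R}) :
  (m1 setT < +oo) ->
  (forall A, measurable A -> m1 (A `*` setT) = m2 (A `*` setT)) ->
  (forall A r, measurable A ->
    m1 (A `*` [set y | y < r%:E]) = m2 (A `*` [set y | y < r%:E])) ->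
  forall D, measurable D -> m1 D = m2 D.
Proof.
move=> m1oo m12T m12r.
(* The point +oo lies in no ray, so rays alone cannot exhaust the space; [setT] is adjoined for
   that. *)
pose C := setT |` @ErealGenInftyO.G R.
have mC : @measurable _ (\bar R) = <<s C >>.
  rewrite [LHS](ErealGenInftyO.measurableE R) eqEsubset; split.
    apply: smallest_sub; first exact: smallest_sigma_algebra.
    by move=> A GA; apply: sub_sigma_algebra; right.
  apply: smallest_sub; first exact: smallest_sigma_algebra.
  move=> A [->|GA]; last exact: sub_sigma_algebra.
  exact: (@measurableT _ (g_sigma_algebraType (@ErealGenInftyO.G R))).
have mXC : @measurable _ (X * \bar R)%type =
    <<s [set A `*` B | A in measurable & B in C] >>.
  rewrite eqEsubset; split; last first.
    apply: smallest_sub; first exact: sigma_algebra_measurable.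
    move=> _ [A mA [B CB <-]]; apply: measurableX => //.
    by rewrite mC; exact: sub_sigma_algebra.
  apply: smallest_sub; first exact: smallest_sigma_algebra.
  rewrite subUset; split.
    move=> _ [A mA <-]; apply: sub_sigma_algebra.
    by exists A => //; exists setT; [left|rewrite setTI setXT].
  have : @measurable_fun _ _ (g_sigma_algebraType
      [set A `*` B | A in @measurable _ X & B in C]) (\bar R) setT snd.
    apply: (measurability _ mC) => _ [B CB <-].
    by apply: sub_sigma_algebra; exists setT => //; exists B.
  by move=> msnd _ [B mB <-]; exact: msnd.
apply: (measure_unique
  [set A `*` B | A in measurable & B in C] (fun=> setT)) => //.
- move=> _ _ [A mA [B CB <-]] [A' mA' [B' CB' <-]].
  rewrite -setXI; exists (A `&` A'); first exact: measurableI.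
  exists (B `&` B') => //.
  case: CB => [->|[r ->]]; first by rewrite setTI.
  case: CB' => [->|[r' ->]]; first by rewrite setIT; right; exists r.
  right; have [rr'|/ltW rr'] := leP r r'; [exists r|exists r'];
    apply/seteqP; split => y /=; rewrite !in_itv/=.
  + by case.
  + by move=> yr; split=> //; rewrite (lt_le_trans yr)// lee_fin.
  + by case.
  + by move=> yr; split=> //; rewrite (lt_le_trans yr)// lee_fin.
- by move=> _; exists setT => //; exists setT; [left|rewrite setXTT].
- by rewrite bigcup_const.
- move=> _ [A mA [B [->|[r ->]] <-]]; first exact: m12T.
  rewrite (_ : `]-oo, r%:E[%classic = [set y | y < r%:E]); first exact: m12r.
  by apply/seteqP; split => y /=; rewrite in_itv.
Qed.

Lemma uniform_prob01_lte (R : realType) (c : \bar R) : 0 <= c <= 1 ->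
  uniform_prob (@ltr01 R) [set t | t%:E < c] = c.
Proof.
case: c => [c| |]; rewrite ?leye_eq ?leeNy_eq ?andbF// !lee_fin => c01.
by rewrite -[RHS]uniform_prob01_lt.
Qed.

Section quantile.
Context d (X : measurableType d) (R : realType).
Variables (mu : probability X R) (P : probability (X * \bar R)%type R).
Hypothesis Pmu : forall A, measurable A -> P (A `*` [set: \bar R]) = mu A.

Lemma exists_quantile : exists G : X * R -> \bar R, measurable_fun setT G /\
  forall D, measurable D ->
    P D = \int[mu]_x uniform_prob (@ltr01 R) [set t | D (x, G (x, t))].
Proof.
have [q qd] := dense_seq R.
pose U : probability _ R := uniform_prob (@ltr01 R).
pose Y r := [set y : \bar R | y < r%:E].
have mY r : measurable (Y r)
  by rewrite -[Y r]setTI; exact: emeasurable_fun_infty_o.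
have /choice[F FP] r := exists_density (mY r) Pmu.
have F0 r x : 0 <= F r x by have [] := FP r.
have Fi r : mu.-integrable setT (F r) by have [] := FP r.
have mF r : measurable_fun setT (F r) by exact: measurable_int (Fi r).
have FE r A : measurable A -> P (A `*` Y r) = \int[mu]_(x in A) F r x.
  by have [_ _] := FP r; apply.
have F_le1 r : {ae mu, forall x, F r x <= 1}.
  apply: le_integral_ae_le => //.
    exact: finite_measure_integrable_cst.
  move=> A mA; rewrite -FE// integral_cst// mul1e.
  apply: (@le_trans _ _ (P (A `*` setT))); last by rewrite Pmu.
  by apply: le_measure; rewrite ?inE;
    [exact: measurableX|exact: measurableX|move=> ? []].
have F_nd r s : (r <= s)%R -> {ae mu, forall x, F r x <= F s x}.
  move=> rs; apply: le_integral_ae_le => // A mA; rewrite -!FE//.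
  apply: le_measure; rewrite ?inE; [exact: measurableX|exact: measurableX|].
  by move=> -[x y] [/= Ax yr]; split => //=;
    rewrite /Y/= (lt_le_trans yr)// lee_fin.
(* The densities are bounded by 1 only almost everywhere. After truncation, [c k x] is for every x
   the uniform mass of the t below it. *)
pose c k x := mine (F (q k) x) 1.
have c01 k x : 0 <= c k x <= 1.
  by rewrite /c le_min F0 lee01/= ge_min lexx orbT.
have mc k : measurable_fun setT (c k) by exact: measurable_mine.
pose S k := [set z : X * R | z.2%:E < c k z.1].
have mS k : measurable (S k).
  rewrite -[S k]setTI; apply: measurable_lte => //.
  - by apply/measurable_EFinP; exact: measurable_snd.
  - exact: measurableT_comp (mc k) measurable_fst.
pose G := level_inf q S.
have GltP z r := level_inf_lt q S z r.
have mGlt := measurable_level_inf_lt q mS.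
have mG : measurable_fun setT G := measurable_level_inf q mS.
exists G; split => //.
pose H r x := U [set t | G (x, t) < r%:E].
have HE r x : H r x = U (xsection [set z | G z < r%:E] x).
  by congr (U _); apply/seteqP; split=> t; rewrite /xsection/= ?inE.
have mHset r x : measurable [set t | G (x, t) < r%:E].
  have := measurable_xsection x (mGlt r); congr measurable.
  by apply/seteqP; split=> t; rewrite /xsection/= ?inE.
have mH r : measurable_fun setT (H r).
  rewrite (_ : H r = U \o xsection [set z | G z < r%:E]); last first.
    by apply/funext => x /=; rewrite HE.
  exact: (@measurable_fun_xsection _ _ _ _ R U _ (mGlt r)).
have mlt (e : \bar R) : measurable [set t : R | t%:E < e].
  by rewrite -[X in measurable X]setTI; apply: emeasurable_fun_infty_o => //;
    exact/measurable_EFinP.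
have U_le (A B : set R) : measurable A -> measurable B -> A `<=` B ->
    U A <= U B.
  by move=> mA mB; exact: (@le_measure _ _ _ U A B (mem_set mA) (mem_set mB)).
(* The t with [G (x, t) < r] are those below some [c k x] with [q k < r], so [H r x] is the supremum
   of these [c k x]. This claim and the next are the two halves of that fact. *)
have le_H r k x : (q k < r)%R -> c k x <= H r x.
  move=> qr; rewrite -(uniform_prob01_lte (c01 k x)).
  apply: U_le => // t /= tk.
  by apply/GltP; exists k.
have H_le r x e : 0 <= e <= 1 -> (forall k, (q k < r)%R -> c k x <= e) ->
    H r x <= e.
  move=> e01 ce; rewrite -[leRHS](uniform_prob01_lte e01).
  apply: U_le => // t /= /GltP[k qr tk].
  exact: lt_le_trans tk (ce _ qr).
have intH r A : measurable A -> \int[mu]_(x in A) H r x = P (A `*` Y r).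
  move=> mA; apply/eqP; rewrite eq_le; apply/andP; split.
    rewrite FE//; apply: ae_ge0_le_integral => //; [exact: measurable_funTS..|].
    (* Each comparison of densities has its own null set; there are countably many k, so one null
       set serves them all. *)
    have : {ae mu, forall x, forall k, (q k < r)%R -> F (q k) x <= F r x}.
      apply: ae_foralln => k.
      have [qr|_] := boolP (q k < r)%R; last exact: aeW.
      by apply: filterS (F_nd _ _ (ltW qr)) => x + _.
    apply: filterS => x qF _.
    apply: (@le_trans _ _ (mine (F r x) 1)); last by rewrite ge_min lexx.
    apply: H_le; first by rewrite le_min F0 lee01/= ge_min lexx orbT.
    by move=> k qr; rewrite /c le_min !ge_min qF// lexx orbT.
  (* For the other inequality, the open ray at r is exhausted by rays at lower levels, and density
     places some [q k] between each such level and r. *)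
  have cvgY : P (A `*` Y (r - n.+1%:R^-1)%R) @[n --> \oo] --> P (A `*` Y r).
    have -> : A `*` Y r = \bigcup_n (A `*` Y (r - n.+1%:R^-1)%R).
      apply/seteqP; split => -[x y].
        move=> [/= Ax]; case: y => [y| |]//; rewrite /Y/=.
          rewrite lte_fin => yr.
          have ry : (0 < r - y)%R by rewrite subr_gt0.
          have [k _ kP] := near_infty_natSinv_lt (PosNum ry).
          exists k => //; split => //=; rewrite lte_fin ltrBrDl -ltrBrDr.
          exact: kP k (leqnn k).
        by move=> _; exists 0%N => //; split => //=; rewrite ltNyr.
      move=> [n _] [/= Ax yr]; split => //=;
        rewrite /Y/= (lt_trans yr)// lte_fin.
      by rewrite gtrBl.
    apply: nondecreasing_cvg_mu.
    - by move=> n; exact: measurableX.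
    - by apply: bigcup_measurable => n _; exact: measurableX.
    - move=> m n mn; apply/subsetPset => -[x y] [/= Ax yr]; split => //=.
      rewrite /Y/= (lt_le_trans yr)// lee_fin lerB// lef_pV2 ?posrE//.
      by rewrite ler_nat.
  rewrite -(cvg_lim _ cvgY)//; apply: lime_le;
    first by apply/cvg_ex; eexists; exact: cvgY.
  apply: nearW => n.
  have [|k /andP[rq qr]] := qd (r - n.+1%:R^-1)%R r; first by rewrite gtrBl.
  apply: (@le_trans _ _ (P (A `*` Y (q k)))).
    apply: le_measure; rewrite ?inE; [exact: measurableX|exact: measurableX|].
    move=> -[x y] [/= Ax yr]; split => //=.
    by rewrite /Y/= (lt_trans yr)// lte_fin.
  rewrite FE//; apply: ae_ge0_le_integral => //; [exact: measurable_funTS..|].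
  apply: filterS (F_le1 (q k)) => x Fx _.
  by apply: le_trans (le_H _ _ _ qr); rewrite /c le_min lexx.
have mh : measurable_fun setT (fun z : X * R => (z.1, G z)).
  by apply: measurable_fun_pair => //; exact: measurable_fst.
have [Q QE] := exists_image (mu \x U)%E mh.
(* [Q] is the law of [(x, G (x, t))], so the right-hand side is [Q D]. By uniqueness, [intH] then
   suffices to identify [Q] with [P]. *)
move=> D mD; transitivity (Q D); last first.
  rewrite QE /product_measure1; apply: eq_integral => x _ /=; congr (U _).
  by apply/seteqP; split=> t; rewrite /xsection/= ?inE.
have QX A B : measurable A -> measurable B ->
    Q (A `*` B) = \int[mu]_(x in A) U [set t | B (G (x, t))].
  move=> mA mB; rewrite QE /product_measure1 [RHS]integral_mkcond.
  apply: eq_integral => x _ /=; rewrite patchE; case: ifPn => [|/negP] xA.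
    congr (U _); apply/seteqP; split=> t; rewrite /xsection/= ?inE.
      by case.
    by split => //=; rewrite inE in xA.
  rewrite (_ : xsection _ _ = set0) ?measure0// -subset0 => t.
  by rewrite /xsection/= inE => -[/= xA' _]; apply: xA; rewrite inE.
apply: eq_measure_prod_ereal mD.
- exact: le_lt_trans (probability_le1 P measurableT) (ltry _).
- move=> A mA; apply: etrans (Pmu mA) _.
  apply: etrans _ (esym (QX _ _ mA measurableT)).
  rewrite (eq_integral (cst 1)); first by rewrite integral_cst// mul1e.
  by move=> x _; exact: probability_setT.
- by move=> A r mA;
  apply: etrans (esym (intH r A mA)) (esym (QX _ _ mA (mY r))).
Qed.

End quantile.

(** * Coding R^n by ternary digits *)

Section ternary.
Variable R : realType.
Implicit Types (s : nat -> bool) (n : nat).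

(** Partial sums of the series of $2 s_i / 3^{i+1}$, unfolded from the leading digit so that the
    recursion passes to the limit as [ternaryE]. *)
Fixpoint ternary_approx n s : R :=
  if n is n'.+1
  then ((s 0%N)%:R * 2 + ternary_approx n' (fun i => s i.+1)) / 3 else 0%R.

Let ternary_approx_ge0 n s : (0 <= ternary_approx n s)%R.
Proof.
elim: n s => //= n IHn s.
by rewrite divr_ge0// addr_ge0// mulr_ge0.
Qed.

Let ternary_approx_le1 n s : (ternary_approx n s <= 1)%R.
Proof.
elim: n s => //= n IHn s; have := IHn (fun i => s i.+1).
by case: (s 0%N) => /= *; lra.
Qed.

Let ternary_approx_nd s : nondecreasing_seq (ternary_approx ^~ s).
Proof.
apply/nondecreasing_seqP => n; elim: n s => [|n IHn] s.
  exact: ternary_approx_ge0.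
by rewrite /= ler_pM2r ?invr_gt0// lerD2l.
Qed.

Let ternary_approx_cvg s : cvgn (ternary_approx ^~ s).
Proof.
by apply: nondecreasing_is_cvgn => //; exists 1%R => _ [n _ <-].
Qed.

(* Points of the Cantor ternary set: digits 0 and 2 only, so that the leading
   digit is read off by comparison with 1/2. *)
Definition ternary s : R := limn (ternary_approx ^~ s).

Let ternary_itv s : (0 <= ternary s <= 1)%R.
Proof.
apply/andP; split.
  by apply: limr_ge => //; exact: nearW.
by apply: limr_le => //; exact: nearW.
Qed.

Lemma ternaryE s :
  ternary s = (((s 0%N)%:R * 2 + ternary (fun i => s i.+1)) / 3)%R.
Proof.
apply/cvg_lim => //; rewrite -cvg_shiftS/=.
by apply: cvgMr_tmp; apply: cvgD; [exact: cvg_cst|exact: ternary_approx_cvg].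
Qed.

(** Solves [ternaryE] for the tail: it deletes the leading digit of a coded sequence. *)
Definition ternary_shift (y : R) : R :=
  if (2^-1 < y)%R then (3 * y - 2)%R else (3 * y)%R.

Definition ternary_digit k (y : R) : bool := (2^-1 < iter k ternary_shift y)%R.

Let lt_ternary s : (2^-1 < ternary s)%R = s 0%N.
Proof.
rewrite ternaryE; have /andP[? ?] := ternary_itv (fun i => s i.+1).
(* A leading digit 2 forces a value of at least 2/3, a leading digit 0 one of at most 1/3. *)
by case: (s 0%N) => /=; [apply/idP|apply/negbTE; rewrite -leNgt]; lra.
Qed.

Lemma ternary_digitE k s : ternary_digit k (ternary s) = s k.
Proof.
have itE : iter k ternary_shift (ternary s) = ternary (fun i => s (k + i)%N).
  elim: k => [//|k IHk]; rewrite iterS IHk /ternary_shift lt_ternary.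
  rewrite (_ : (fun i => s (k.+1 + i)%N) = (fun i => s (k + i.+1)%N));
    last first.
    by apply/funext => i; rewrite addSnnS.
  by rewrite [ternary (fun i => s (k + i)%N)]ternaryE; case: (s _) => /=; lra.
by rewrite /ternary_digit itE lt_ternary addn0.
Qed.

Lemma measurable_ternary_digit k : measurable_fun setT (ternary_digit k).
Proof.
apply: measurable_fun_ltr => //; elim: k => [|k IHk] /=;
  first exact: measurable_id.
apply: measurableT_comp IHk; apply: measurable_fun_ifT => //.
  exact: measurable_fun_ltr.
by apply: measurable_funB => //; exact: measurable_funM.
Qed.

Lemma measurable_ternary d (T : measurableType d) (b : nat -> T -> bool) :
  (forall k, measurable_fun setT (b k)) ->
  measurable_fun setT (fun x => ternary (b ^~ x)).
Proof.
move=> mb;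
  apply: (measurable_fun_cvg (h := fun n x => ternary_approx n (b ^~ x))).
  move=> n; elim: n b mb => [|n IHn] b mb /=; first exact: measurable_cst.
  apply: measurable_funM => //; apply: measurable_funD.
    apply: measurable_funM => //; under eq_fun do rewrite mulrb.
    exact: measurable_fun_ifT.
  exact: (IHn (fun k => b k.+1)).
by move=> x _; exact: ternary_approx_cvg.
Qed.

End ternary.

Section Rn.
Context (R : realType) (n : nat).

Lemma measurable_coord (j : 'I_n) :
  measurable_fun setT (fun v : Rn R n => (v : 'rV[R]_n) ord0 j).
Proof.
apply: (measurability _ (RGenOInfty.measurableE R)) => _ [_ [r ->] <-].
rewrite setTI; apply: sub_sigma_algebra.
apply: open_comp; last exact: interval_open.
by move=> v _; exact: coord_continuous.
Qed.

(** An open set is a countable union of balls with rational centre and radius 1/(k+1). These are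
    boxes for the norm in use, so their preimages are finite intersections of conditions on single
    coordinates. *)
Lemma measurable_row d (T : measurableType d) (f : T -> Rn R n) :
  (forall j, measurable_fun setT (fun t => (f t : 'rV[R]_n) ord0 j)) ->
  measurable_fun setT f.
Proof.
move=> mf; apply: measurability; first reflexivity.
move=> _ [U oU <-]; rewrite setTI.
pose c (p : 'rV[rat]_n) : 'rV[R]_n := map_mx ratr p.
pose box (i : 'rV[rat]_n * nat) : set 'rV[R]_n := ball (c i.1) i.2.+1%:R^-1.
pose F i : set 'rV[R]_n := if `[< box i `<=` U >] then box i else set0.
have mbox i : measurable (f @^-1` box i).
  rewrite (_ : f @^-1` _ = \bigcap_(j in [set: 'I_n])
      [set t | `|c i.1 ord0 j - (f t : 'rV[R]_n) ord0 j| < i.2.+1%:R^-1]%R).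
    apply: fin_bigcap_measurable => // j _; rewrite -[X in measurable X]setTI.
    apply: measurable_fun_ltr => //.
    by apply: measurableT_comp => //; exact: measurable_funB.
  apply/seteqP; split => t /=; first by move=> [_ ft] j _; exact: ft.
  by move=> ft; split => // k j; rewrite !ord1; exact: ft.
suff -> : f @^-1` U = \bigcup_i (f @^-1` F i).
  apply: countable_bigcupT_measurable; first exact: countableP.
  by move=> i; rewrite /F; case: ifPn => _; rewrite ?preimage_set0.
rewrite -preimage_bigcup; congr (f @^-1` _).
rewrite eqEsubset; split => [x Ux|z [i _]]; last first.
  by rewrite /F; case: ifPn => // /asboolP; exact.
have [e /= e0 eU] : nbhs_ball x U by apply/nbhs_ballP; exact: open_nbhs_nbhs.
(* With radius below e/2, any such ball containing x stays within distance e of x. *)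
have [k ke] : exists k : nat, (k.+1%:R^-1 < e / 2 :> R)%R.
  have e20 : (0 < e / 2)%R by rewrite divr_gt0.
  have [k _ kP] := near_infty_natSinv_lt (PosNum e20).
  by exists k; exact: kP k (leqnn k).
have k0 : (0 < k.+1%:R^-1 :> R)%R by rewrite invr_gt0.
have [p xp] : exists p, ball (c p) k.+1%:R^-1 x.
  have /choice[p pP] : forall j, exists r : rat,
    (`|x ord0 j - ratr r| < k.+1%:R^-1)%R.
    move=> j; have /rat_in_itvoo[r] : (x ord0 j - k.+1%:R^-1 < x ord0 j +
      k.+1%:R^-1)%R.
      by rewrite ltrD2l gtrN.
    by rewrite in_itv/= => rj; exists r; rewrite ltr_distlC.
  exists (\row_j p j); split => // i j.
  by rewrite !mxE -ball_normE /= distrC ord1.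
exists (p, k) => //; rewrite /F ifT //; apply/asboolP => y py; apply: eU.
rewrite [e]splitr; apply: (@ball_triangle _ _ (c p)).
  exact/ball_sym/(le_ball (ltW ke)).
exact: (le_ball (ltW ke)).
Qed.

Lemma measurable_addv : measurable_fun setT
  (fun p : TRn R n => ((p.1 : 'rV[R]_n) + (p.2 : 'rV[R]_n))%R : Rn R n).
Proof.
apply: measurable_row => j; under eq_fun do rewrite mxE.
by apply: measurable_funD; apply: measurableT_comp (measurable_coord j) _.
Qed.

(** Each pair (j, i) owns the digit at position [pickle (j, i)], and $v_j$ is recovered as the
    infimum of the $q_i$ above it. Away from codes [g] only has to be measurable; there [fine] turns
    infinite infima into 0. *)
Lemma Rn_real_retract : exists (f : Rn R n -> R) (g : R -> Rn R n),
  [/\ measurable_fun setT f, measurable_fun setT g & cancel f g].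
Proof.
have [q qd] := dense_seq R.
pose b k (v : Rn R n) := if unpickle k is Some (j, i)
  then ((v : 'rV[R]_n) ord0 j < q i)%R else false.
pose A j i := [set y : R | ternary_digit (pickle (j : 'I_n, i : nat)) y].
pose g y : Rn R n := \row_j fine (level_inf q (A j) y).
exists (fun v => ternary R (b ^~ v)), g; split.
- apply: measurable_ternary => k; rewrite /b.
  case: unpickle => [[j i]|]; last exact: measurable_cst.
  by apply: measurable_fun_ltr => //; exact: measurable_coord.
- apply: measurable_row => j; rewrite /g; under eq_fun do rewrite mxE.
  apply: measurableT_comp => //; apply: measurable_level_inf => i.
  rewrite -[A j i]setTI.
  exact: (@measurable_ternary_digit R (pickle (j, i)) measurableT [set true] I).
- move=> v; apply/rowP => j; rewrite mxE.
  suff -> : level_inf q (A j) (ternary R (b ^~ v)) = ((v : 'rV[R]_n) ord0 j)%:E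
    by [].
  have AE i : A j i (ternary R (b ^~ v)) = ((v : 'rV[R]_n) ord0 j < q i)%R.
    by rewrite /A/= ternary_digitE /b pickleK.
  apply/eqP; rewrite eq_le; apply/andP; split.
    apply/lee_addgt0Pr => e e0; apply/ltW; rewrite -EFinD.
    have [|k /andP[vk ke]] :=
      qd ((v : 'rV[R]_n) ord0 j) ((v : 'rV[R]_n) ord0 j + e)%R.
      by rewrite ltrDl.
    by apply/level_inf_lt; exists k => //; rewrite AE.
  apply: le_ereal_inf_tmp => _ [k /= Ak <-]; rewrite lee_fin ltW//.
  by rewrite -AE.
Qed.

End Rn.

(** * Kernels and disintegrations *)

Section pker.
Context d d' (X : measurableType d) (Y : measurableType d') (R : realType).

(* Declares the values of a probability kernel as probability measures, so that
   Fubini's theorem and product measures apply to them. *)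
Definition pker_prob (k : R.-pker X ~> Y) (x : X) : set Y -> \bar R := k x.

HB.instance Definition _ k x := Measure.on (@pker_prob k x).

HB.instance Definition _ k x :=
  Measure_isProbability.Build _ _ _ (@pker_prob k x) (prob_kernel x).

Section of_probability.
Variable nu : X -> probability Y R.
Hypothesis mnu : forall B, measurable B -> measurable_fun setT (nu ^~ B).

Definition pker_of (x : X) : {measure set Y -> \bar R} := nu x.

HB.instance Definition _ := isKernel.Build _ _ _ _ _ pker_of mnu.

Let ker_setT x : pker_of x setT = 1.
Proof. exact: probability_setT. Qed.

HB.instance Definition _ :=
  Kernel_isProbability.Build _ _ _ _ _ pker_of ker_setT.

Lemma exists_pker :
  exists k : R.-pker X ~> Y, forall x, k x = nu x :> {measure set Y -> \bar R}.
Proof. by exists pker_of. Qed.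

End of_probability.

End pker.

Section exists_probability.
Context d (T : measurableType d) (R : realType).
Variable m : {measure set T -> \bar R}.
Hypothesis m1 : m setT = 1.

Definition probability_of : set T -> \bar R := m.

HB.instance Definition _ := Measure.on probability_of.

HB.instance Definition _ := Measure_isProbability.Build _ _ _ probability_of m1.

Lemma exists_probability : exists P : probability T R, forall A, P A = m A.
Proof. by exists probability_of. Qed.

End exists_probability.

Section semidirect.
Context d d' (X : measurableType d) (Y : measurableType d') (R : realType).
Variables (mu : probability X R) (k : R.-pker X ~> Y).

Let slice_prob x : probability (X * Y)%type R :=
  distribution (pker_prob k x) (mfun_Sub (mem_set (pair1_measurable x))).

Lemma measurable_integral_pker (f : X * Y -> \bar R) :
  measurable_fun setT f -> (forall z, 0 <= f z) ->
  measurable_fun setT (fun x => \int[k x]_y f (x, y)).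
Proof. by move=> mf f0; exact: measurable_fun_integral_finite_kernel. Qed.

(** The measure is the Giry bind of [mu] along the map sending x to the law of (x, y) with y
    distributed by [k x]. Its integration formula at the constant 1 yields total mass one. *)
Lemma exists_semidirect : exists P : probability (X * Y)%type R,
  forall phi, measurable_fun setT phi -> (forall z, 0 <= phi z) ->
    \int[P]_z phi z = \int[mu]_x \int[k x]_y phi (x, y).
Proof.
have ms : measurable_fun setT (slice_prob : X -> giry (X * Y)%type R).
  apply: measurable_giry_codensity => // D mD.
  pose f (z : X * Y) : \bar R := (\1_D z)%:E.
  have mf : measurable_fun setT f by exact/measurable_EFinP.
  rewrite (_ : (fun x => _) = (fun x => \int[k x]_y f (x, y))).
    by apply: measurable_integral_pker => // z; rewrite lee_fin.
  apply/funext => x; rewrite /f.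
  under eq_integral do rewrite -[\1_D _]/(\1_(pair x @^-1` D) _).
  rewrite integral_indic ?setIT//.
  by rewrite -[X in measurable X]setTI; exact: pair1_measurable.
pose Q := giry_bind (mu : giry X R) ms.
have Qint phi : measurable_fun setT phi -> (forall z, 0 <= phi z) ->
    \int[Q]_z phi z = \int[mu]_x \int[k x]_y phi (x, y).
  move=> mphi phi0; apply: etrans (giry_int_bind _ ms mphi phi0) _.
  apply: eq_integral => x _.
  by rewrite /giry_int ge0_integral_distribution.
have Q1 : Q setT = 1.
  rewrite -[LHS]mul1e -integral_cst// Qint//.
  transitivity (\int[mu]_x cst 1 x).
    by apply: eq_integral => x _; rewrite integral_cst//= mul1e prob_kernel.
  by rewrite integral_cst// mul1e; exact: probability_setT.
have [P PQ] := exists_probability Q1.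
exists P => phi mphi phi0; rewrite -Qint//.
by apply: eq_measure_integral => A _ _; exact: PQ.
Qed.

(** Reduces a disintegration identity to indicators: they already force [P] to agree on measurable
    sets with the measure of [exists_semidirect]. *)
Lemma semidirect_unique (P : probability (X * Y)%type R) :
  (forall B, measurable B ->
    P B = \int[mu]_x \int[k x]_y (\1_B (x, y))%:E) ->
  forall phi, measurable_fun setT phi -> (forall z, 0 <= phi z) ->
    \int[P]_z phi z = \int[mu]_x \int[k x]_y phi (x, y).
Proof.
move=> PE phi mphi phi0; have [Q QE] := exists_semidirect.
rewrite -QE//; apply: eq_measure_integral => B mB _.
apply: etrans (PE B mB) _; rewrite -(QE (EFin \o \1_B)).
- by rewrite integral_indic// setIT.
- exact/measurable_EFinP.
- by move=> z; rewrite lee_fin.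
Qed.

End semidirect.

(** [P] is transported by [f] to the extended line, and [nu x] is the law of the quantile [G (x, t)]
    for uniform t, carried back by [g]. *)
Lemma exists_disintegration d d' (X : measurableType d) (Y : measurableType d')
    (R : realType) (mu : probability X R) (P : probability (X * Y)%type R)
    (f : Y -> R) (g : R -> Y) :
  measurable_fun setT f -> measurable_fun setT g -> cancel f g ->
  (forall A, measurable A -> P (A `*` setT) = mu A) ->
  exists nu : R.-pker X ~> Y,
    forall phi, measurable_fun setT phi -> (forall z, 0 <= phi z) ->
      \int[P]_z phi z = \int[mu]_x \int[nu x]_y phi (x, y).
Proof.
move=> mf mg fK Pmu.
have mh : measurable_fun setT (fun z : X * Y => (z.1, (f z.2)%:E)).
  apply: measurable_fun_pair; first exact: measurable_fst.
  by apply/measurable_EFinP; exact: measurableT_comp.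
have [P' P'E] := exists_image P mh.
have [|G [mG PG]] := @exists_quantile _ X R mu P'.
  by move=> A mA; rewrite P'E -Pmu//; congr (P _); apply/seteqP; split => -[].
pose U : probability _ R := uniform_prob (@ltr01 R).
pose h (z : X * R) := g (fine (G z)).
have mhG : measurable_fun setT h by do 2!apply: measurableT_comp => //.
have mhx x : measurable_fun setT (fun t : R => h (x, t)).
  exact: measurableT_comp (pair1_measurable x).
have /choice[nu nuE] x := exists_image U (mhx x).
have [|k kE] := @exists_pker _ _ X Y R nu.
  move=> B mB.
  have mhB : measurable (h @^-1` B)
    by rewrite -[X in measurable X]setTI; exact: mhG.
  have := @measurable_fun_xsection _ _ _ _ R U _ mhB.
  congr measurable_fun; apply/funext => x /=; rewrite nuE; congr (U _).
  by apply/seteqP; split=> t; rewrite /xsection/= ?inE.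
exists k; apply: semidirect_unique => B mB.
have mgB : measurable [set z : X * \bar R | B (z.1, g (fine z.2))].
  rewrite -[X in measurable X]setTI.
  suff : measurable_fun setT
    (fun z : X * \bar R => (z.1, g (fine z.2))) by apply.
  apply: measurable_fun_pair; first exact: measurable_fst.
  by do 2!apply: measurableT_comp => //.
(* Under [P'] the second coordinate is some [f y], hence finite: the value 0 of [fine] at infinity
   does no harm, and [g] undoes [f]. *)
transitivity (P' [set z | B (z.1, g (fine z.2))]).
  by rewrite P'E; congr (P _); apply/seteqP; split => -[x y]/=; rewrite fK.
rewrite PG//; apply: eq_integral => x _.
under eq_integral do rewrite -[\1_B _]/(\1_(pair x @^-1` B) _).
rewrite integral_indic//.
  by rewrite setIT kE; exact/esym/nuE.
by rewrite -[X in measurable X]setTI; exact: pair1_measurable.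
Qed.

Lemma measure_int d (T : measurableType d) (R : realType)
    (m : {measure set T -> \bar R}) (A : set T) :
  measurable A -> m A = \int[m]_x (\1_A x)%:E.
Proof. by move=> mA; rewrite integral_indic// setIT. Qed.

(** * Fiber convolution *)

Section fiber_convolution.
Context (R : realType) (n : nat).
Local Notation E := (Rn R n).
Local Notation TE := (TRn R n).
Implicit Types (mu : borel_prob E R) (nu k : R.-pker E ~> E) (B : set TE).
Implicit Types V W : prob_vector_field R n.

Let add (v w : E) : E := ((v : 'rV[R]_n) + (w : 'rV[R]_n))%R.

Let measurable_add d (T : measurableType d) (f g : T -> E) :
  measurable_fun setT f -> measurable_fun setT g ->
  measurable_fun setT (fun t => add (f t) (g t)).
Proof.
move=> mf mg.
exact: (measurableT_comp (@measurable_addv R n) (measurable_fun_pair mf mg)).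
Qed.

Let measurable_indic_add d (T : measurableType d) (f g h : T -> E)
    (B : set TE) :
  measurable B -> measurable_fun setT f -> measurable_fun setT g ->
  measurable_fun setT h ->
  measurable_fun setT (fun t => (\1_B (f t, add (g t) (h t)))%:E : \bar R).
Proof.
move=> mB mf mg mh; apply/measurable_EFinP.
apply: (measurableT_comp (measurable_indic mB)).
exact: measurable_fun_pair mf (measurable_add mg mh).
Qed.

Let m12 : measurable_fun setT (fun z : (E * E) * E => z.1.2).
Proof. exact: measurableT_comp measurable_snd measurable_fst. Qed.

Lemma eq_pvf V W :
  (forall mu B, measurable B -> V mu B = W mu B) -> V = W.
Proof.
move=> VW; have : pvf_fun V = pvf_fun W.
  by apply/funext => mu; apply: borel_prob_eq => B; exact: VW.
case: V W {VW} => [V HV] [W HW] /= VW.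
by case: _ / VW HW => HW; congr Pvf; exact: Prop_irrelevance.
Qed.

Lemma pvf_disintegration V mu :
  exists nu : R.-pker E ~> E, disintegration mu nu (V mu).
Proof.
have [f [g [mf mg fK]]] := Rn_real_retract R n.
apply: exists_disintegration mf mg fK _ => A mA.
by rewrite -[RHS](pvf_base V mu mA); congr (V mu _); apply/seteqP;
  split => -[? ?] // [].
Qed.

(** A PVF carries no regularity in [mu], so the measures are built separately for each [mu] and
    collected by choice. *)
Lemma exists_pvf (K : borel_prob E R -> R.-pker E ~> E) :
  exists V, forall mu, disintegration mu (K mu) (V mu).
Proof.
have /choice[V VE] mu : exists Q : borel_prob TE R, disintegration mu (K mu) Q.
  have [P PE] := exists_semidirect mu (K mu).
  have [Q [QP _]] := borel_prob_unique P.
  exists Q => phi mphi phi0; apply: etrans _ (PE phi mphi phi0).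
  by apply: eq_measure_integral => A mA _; exact: QP.
have Vbase mu A : measurable A -> pushforward (V mu) fst A = mu A.
  move=> mA.
  have mfA : measurable (@fst E E @^-1` A).
    by rewrite -[X in measurable X]setTI; exact: measurable_fst.
  apply: etrans (measure_int (V mu) mfA) _.
  rewrite (VE mu (EFin \o \1_(fst @^-1` A))).
  - transitivity (\int[mu]_x (\1_A x)%:E); last exact/esym/measure_int.
    apply: eq_integral => x _.
    transitivity (\int[K mu x]_v cst (\1_A x)%:E v); first exact: eq_integral.
    by rewrite integral_cst// prob_kernel mule1.
  - exact/measurable_EFinP.
  - by move=> z; rewrite lee_fin.
by exists (Pvf Vbase).
Qed.

Section kernels.
Variables nu1 nu2 : R.-pker E ~> E.

(** Here [nu2] is regarded as a kernel from pairs (x, v) that ignores v. *)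
Lemma measurable_integral_pker_fst (f : (E * E) * E -> \bar R) :
  measurable_fun setT f -> (forall z, 0 <= f z) ->
  measurable_fun setT (fun z : E * E => \int[nu2 z.1]_w f (z, w)).
Proof.
move=> mf f0.
have [|k kE] := @exists_pker _ _ (E * E)%type E R (fun z => pker_prob nu2 z.1).
  move=> B mB;
    exact: measurableT_comp (measurable_kernel nu2 B mB) measurable_fst.
have := measurable_integral_pker k mf f0.
by congr measurable_fun; apply/funext => z; rewrite kE.
Qed.

(** Each [k x] is the ordinary convolution of [nu1 x] and [nu2 x], expressed by integrals so that it
    can be substituted into iterated ones. *)
Definition is_conv_pker k : Prop :=
  forall x phi, measurable_fun setT phi -> (forall v, 0 <= phi v) ->
    \int[k x]_v phi v = \int[nu1 x]_v \int[nu2 x]_w phi (add v w).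

(** Fiberwise this is the image of the product measure under addition. Measurability in x comes from
    writing the mass of a set as an iterated integral, one kernel at a time. *)
Lemma exists_conv_pker : exists k, is_conv_pker k.
Proof.
have madd : measurable_fun setT (fun p : TE => add p.1 p.2) :=
  @measurable_addv R n.
pose nu x : probability E R := distribution
  (pker_prob nu1 x \x pker_prob nu2 x) (mfun_Sub (mem_set madd)).
have nuE x phi : measurable_fun setT phi -> (forall v, 0 <= phi v) ->
    \int[nu x]_v phi v = \int[nu1 x]_v \int[nu2 x]_w phi (add v w).
  move=> mphi phi0; rewrite ge0_integral_distribution//.
  have mf := measurableT_comp mphi madd.
  apply: (fubini_tonelli1 (m1 := pker_prob nu1 x) (m2 := pker_prob nu2 x) _ mf).
  by move=> z; exact: phi0.
have [|k kE] := @exists_pker _ _ E E R nu; last first.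
  by exists k => x phi mphi phi0; rewrite kE -nuE.
move=> B mB.
pose f (z : (E * E) * E) : \bar R := (\1_B (add z.1.2 z.2))%:E.
have mf : measurable_fun setT f.
  apply/measurable_EFinP; apply: (measurableT_comp (measurable_indic mB)).
  exact: measurable_add m12 measurable_snd.
have f0 z : 0 <= f z by rewrite lee_fin.
have := measurable_integral_pker nu1 (measurable_integral_pker_fst mf f0).
have /[swap]/[apply] : forall z : E * E, 0 <= \int[nu2 z.1]_w f (z, w).
  by move=> z; exact: integral_ge0.
congr measurable_fun; apply/funext => x.
apply: etrans _ (esym (measure_int (nu x) mB)); rewrite nuE//.
exact/measurable_EFinP.
Qed.

Lemma fiber_convE mu B : measurable B ->
  fiber_conv mu nu1 nu2 B =
  \int[mu]_x \int[nu1 x]_v \int[nu2 x]_w (\1_B (x, add v w))%:E.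
Proof.
move=> mB; apply: eq_integral => x _.
pose f (p : TE) : \bar R := (\1_B (x, add p.1 p.2))%:E.
have mf : measurable_fun setT f by exact: measurable_indic_add.
have f0 p : 0 <= f p by rewrite lee_fin.
exact: (fubini_tonelli1 (m1 := pker_prob nu1 x) (m2 := pker_prob nu2 x) f).
Qed.

End kernels.

Lemma fiber_convC nu1 nu2 mu B : measurable B ->
  fiber_conv mu nu1 nu2 B = fiber_conv mu nu2 nu1 B.
Proof.
move=> mB; rewrite !fiber_convE//; apply: eq_integral => x _.
pose f (p : TE) : \bar R := (\1_B (x, add p.1 p.2))%:E.
have mf : measurable_fun setT f by exact: measurable_indic_add.
have f0 p : 0 <= f p by rewrite lee_fin.
apply: etrans (fubini_tonelli (m1 := pker_prob nu1 x)
  (m2 := pker_prob nu2 x) f mf f0) _.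
by apply: eq_integral => w _; apply: eq_integral => v _;
  rewrite /f/= /add addrC.
Qed.

Lemma eq_fiber_convl nu1 nu1' nu2 mu (P : probability TE R) B : measurable B ->
  disintegration mu nu1 P -> disintegration mu nu1' P ->
  fiber_conv mu nu1 nu2 B = fiber_conv mu nu1' nu2 B.
Proof.
move=> mB P1 P1'; rewrite !fiber_convE//.
pose f (z : (E * E) * E) : \bar R := (\1_B (z.1.1, add z.1.2 z.2))%:E.
have mf : measurable_fun setT f.
  apply: measurable_indic_add => //.
  exact: measurableT_comp measurable_fst measurable_fst.
have f0 z : 0 <= f z by rewrite lee_fin.
have mg := measurable_integral_pker_fst nu2 mf f0.
have g0 z : 0 <= \int[nu2 z.1]_w f (z, w) by exact: integral_ge0.
(* Both sides are the integral over [P] of the same function of (x, v). *)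
by rewrite -(P1 _ mg g0) -(P1' _ mg g0).
Qed.

Lemma eq_fiber_conv nu1 nu1' nu2 nu2' mu (P Q : probability TE R) B :
  measurable B ->
  disintegration mu nu1 P -> disintegration mu nu1' P ->
  disintegration mu nu2 Q -> disintegration mu nu2' Q ->
  fiber_conv mu nu1 nu2 B = fiber_conv mu nu1' nu2' B.
Proof.
move=> mB P1 P1' Q2 Q2'; apply: etrans (eq_fiber_convl nu2 mB P1 P1') _.
apply: etrans (fiber_convC nu1' nu2 mu mB) _.
by apply: etrans (eq_fiber_convl nu1' mB Q2 Q2') _; exact: fiber_convC.
Qed.

Lemma disintegrationE nu mu (P : probability TE R) B : measurable B ->
  disintegration mu nu P -> P B = \int[mu]_x \int[nu x]_v (\1_B (x, v))%:E.
Proof.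
move=> mB Pnu; apply: etrans (measure_int P mB) _.
apply: (Pnu (EFin \o \1_B)); first exact/measurable_EFinP.
by move=> z; rewrite lee_fin.
Qed.

Lemma fiber_conv_conv_pker nu1 nu2 k mu B : measurable B ->
  is_conv_pker nu1 nu2 k ->
  fiber_conv mu nu1 nu2 B = \int[mu]_x \int[k x]_v (\1_B (x, v))%:E.
Proof.
move=> mB kE; rewrite fiber_convE//; apply: eq_integral => x _.
rewrite (kE x (fun v => (\1_B (x, v))%:E)) => //.
by apply/measurable_EFinP; apply: measurableT_comp.
Qed.

(** The default of [xget] never occurs: convolving one chosen pair of disintegrations for each [mu]
    gives a PVF, and [eq_fiber_conv] extends its defining equation to every other pair. *)
Lemma fiber_sumP V1 V2 : is_fiber_sum V1 V2 (fiber_sum V1 V2).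
Proof.
rewrite /fiber_sum; case: xgetP => [W _ //|noW]; exfalso.
have /choice[nu1 nu1P] := pvf_disintegration V1.
have /choice[nu2 nu2P] := pvf_disintegration V2.
have /choice[k kE] mu := exists_conv_pker (nu1 mu) (nu2 mu).
have [W WE] := exists_pvf k.
apply: (noW W) => mu nu1' nu2' nu1'P nu2'P B mB.
rewrite (eq_fiber_conv mB nu1'P (nu1P mu) nu2'P (nu2P mu)).
by rewrite (disintegrationE mB (WE mu)) (fiber_conv_conv_pker _ mB (kE mu)).
Qed.

(** Supplies a disintegration of an inner sum, which makes [fiber_sumP] applicable to nested
    sums. *)
Lemma fiber_sum_disintegration V1 V2 mu nu1 nu2 k :
  disintegration mu nu1 (V1 mu) -> disintegration mu nu2 (V2 mu) ->
  is_conv_pker nu1 nu2 k ->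
  disintegration mu k (fiber_sum V1 V2 mu).
Proof.
move=> nu1P nu2P kE; apply: semidirect_unique => B mB.
by rewrite -(fiber_conv_conv_pker _ mB kE); exact: fiber_sumP.
Qed.

Lemma fiber_sumC : commutative (@fiber_sum R n).
Proof.
move=> V1 V2; apply: eq_pvf => mu B mB.
have [nu1 nu1P] := pvf_disintegration V1 mu.
have [nu2 nu2P] := pvf_disintegration V2 mu.
by rewrite (fiber_sumP nu1P nu2P mB) (fiber_sumP nu2P nu1P mB) fiber_convC.
Qed.

Lemma fiber_sumA : associative (@fiber_sum R n).
Proof.
move=> V1 V2 V3; apply: eq_pvf => mu B mB.
have [nu1 nu1P] := pvf_disintegration V1 mu.
have [nu2 nu2P] := pvf_disintegration V2 mu.
have [nu3 nu3P] := pvf_disintegration V3 mu.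
have [k12 k12E] := exists_conv_pker nu1 nu2.
have [k23 k23E] := exists_conv_pker nu2 nu3.
rewrite (fiber_sumP nu1P (fiber_sum_disintegration nu2P nu3P k23E) mB).
rewrite (fiber_sumP (fiber_sum_disintegration nu1P nu2P k12E) nu3P mB).
rewrite !fiber_convE//; apply: eq_integral => x _.
have mBx v : measurable_fun setT (fun w => (\1_B (x, add v w))%:E : \bar R).
  exact: measurable_indic_add.
pose f (z : E * E) : \bar R := (\1_B (x, add z.1 z.2))%:E.
have mf : measurable_fun setT f by exact: measurable_indic_add.
(* Expanding [k12] and [k23] turns both sides into triple integrals against [nu1 x], [nu2 x],
   [nu3 x] that differ only in the bracketing of the sum. *)
rewrite (k12E x (fun u => \int[nu3 x]_w (\1_B (x, add u w))%:E)).
- apply: eq_integral => v _; apply: etrans (k23E x _ (mBx v) _) _.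
    by move=> w; rewrite lee_fin.
  by apply: eq_integral => w _; apply: eq_integral => u _; rewrite /add addrA.
- apply: (measurable_fun_fubini_tonelli_F (m2 := pker_prob nu3 x) f) => //.
  by move=> z; rewrite lee_fin.
- by move=> v; apply: integral_ge0 => w _; rewrite lee_fin.
Qed.

(** The unit is the zero vector field, which sends [mu] to $\mu\otimes\delta_0$. *)
Lemma fiber_sum_unit : exists e, left_id e (@fiber_sum R n).
Proof.
pose k0 : R.-pker E ~> E :=
  kdirac (@measurable_cst _ _ E E setT (0%R : 'rV[R]_n)).
have [e eP] := exists_pvf (fun=> k0).
exists e => V; apply: eq_pvf => mu B mB.
have [nu nuP] := pvf_disintegration V mu.
rewrite (fiber_sumP (eP mu) nuP mB) fiber_convE// (disintegrationE mB nuP).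
apply: eq_integral => x _.
pose f (z : E * E) : \bar R := (\1_B (x, add z.1 z.2))%:E.
have mf : measurable_fun setT f by exact: measurable_indic_add.
have f0 z : 0 <= f z by rewrite lee_fin.
rewrite /k0 /kdirac integral_dirac//.
  rewrite diracT mul1e; apply: eq_integral => w _.
  by rewrite /add add0r.
exact: (measurable_fun_fubini_tonelli_F (m2 := pker_prob nu x) f).
Qed.

End fiber_convolution.

(* The first two clauses say that [fiber_sum] is a well-defined operation on
   the set of PVFs: disintegrations exist, and for any choice of them the fiber
   convolution is the PVF [fiber_sum V1 V2]. *)
Theorem proposition6p3 (R : realType) (n : nat) :
  [/\ forall (V : prob_vector_field R n) (mu : borel_prob (Rn R n) R),
        exists nu : R.-pker (Rn R n) ~> (Rn R n), disintegration mu nu (V mu),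
      forall V1 V2 : prob_vector_field R n, is_fiber_sum V1 V2 (fiber_sum V1 V2),
      associative (@fiber_sum R n),
      commutative (@fiber_sum R n) &
      exists e : prob_vector_field R n,
        left_id e (@fiber_sum R n) /\ right_id e (@fiber_sum R n)].
Proof.
split.
- exact: pvf_disintegration.
- exact: fiber_sumP.
- exact: fiber_sumA.
- exact: fiber_sumC.
- have [e e0] := fiber_sum_unit R n.
  by exists e; split => // V; rewrite fiber_sumC.
Qed.
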